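(* Let $f:\mathbb{R}^N\to\mathbb{R}$ be a differentiable function whose set of minimizers is nonempty, such that, for constants $L>0$ and $L_r$, $|\nabla_i f(x)-\nabla_i f(x+\alpha e_i)|\le L|\alpha|$ for all $x\in\mathbb{R}^N$, $\alpha\in\mathbb{R}$, $i\in[N]$, and $\|\nabla f(x)-\nabla f(x+s)\|\le L_r\|s\|$ for all $x,s\in\mathbb{R}^N$. Let the Markov chain assumption of the context hold, and let $\tau\ge 1$ be the $\frac{\pi^*_{\min}}{2}$-mixing time defined there. Let $(x^k)_{k\ge0}$ be generated by the inexact Markov chain block coordinate gradient descent (inexact MC-BCD) described in the context, with any constant stepsize $0<\gamma<\frac{2}{L}$ and errors $(\epsilon^k)_{k\ge 0}$. Put $$C_1(\tau):=\frac{4\gamma}{2-L\gamma}\Big(2L_r^2(\tau-1)^2+\frac{4}{\gamma^2}\Big),\qquad C_2(\tau):=\frac{4\gamma^2}{(2-L\gamma)^2}\Big(2L_r^2(\tau-1)^2+\frac{4}{\gamma^2}\Big).$$ Then the following hold. 1. (Square summable noise.) If $\sum_{k=0}^\infty\|\epsilon^k\|^2=\mathcal{E}<+\infty$, then $$\lim_{k\to\infty}\mathbb{E}\|\nabla f(x^k)\|=0,$$ and $$\mathbb{E}\Big[\min_{0\le t\le k}\|\nabla f(x^t)\|^2\Big]\le\frac{2}{(k+1)\pi^*_{\min}}\Big[C_1(\tau)\big(f(x^0)-\min f\big)+\big(C_2(\tau)+4\big)\mathcal{E}\Big].$$ 2. (Non-square-summable noise.) If $\|\epsilon^k\|^2\le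 S$ for all $k\ge 0$, for some number $S>0$, then $$\mathbb{E}\Big[\min_{0\le t\le k}\|\nabla f(x^t)\|^2\Big]\le\frac{2}{(k+1)\pi^*_{\min}}C_1(\tau)\big(f(x^0)-\min f\big)+\frac{2}{\pi^*_{\min}}\Big(\frac{C_2(\tau)(k+\tau)}{k+1}+4\Big)S.$$
   Context: Notation: $[N]=\{1,\dots,N\}$; $e_i$ is the $i$th standard basis vector; $\nabla_i f$ is the $i$th partial derivative; $\|\cdot\|$ is the Euclidean norm; $\|\cdot\|_2$ on matrices is the spectral norm. Markov chain assumption: $(P(k))_{k\ge0}$ are $N\times N$ transition (row-stochastic) matrices on state space $[N]$ (with $P_{i,j}(k)=0$ unless $(i,j)$ is an edge of a given strongly connected graph on $[N]$), and the chain has a stationary distribution $\pi^*=(\pi^*_1,\dots,\pi^*_N)$, a probability row vector with $\pi^*_{\min}:=\min_i\pi^*_i>0$. Let $\Pi^*\in\mathbb{R}^{N\times N}$ be the matrix all of whose rows equal $\pi^*$, and $\Phi(m,n):=P(m)P(m+1)\cdots P(m+n)$ for $m,n\ge0$. It is assumed that for each $\epsilon>0$ there is $\tau_\epsilon\ge1$ with $\|\Phi(m,n)-\Pi^*\|_2<\epsilon$ for all $m\ge0$, $n\ge\tau_\epsilon-1$. Mixing time: $\tau\ge1$ is an integer such that $\|\Phi(m,n)-\Pi^*\|_2\le\frac{\pi^*_{\min}}{2}$ for all $m\ge0$ and all $n\ge\tau-1$. Inexact MC-BCD: the initial point $x^0\in\mathbb{R}^N$ is arbitrary, and the initial block $i_0\in[N]$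 may be chosen either deterministically or randomly. For $k\ge1$, $i_k$ is sampled according to the Markov chain: given the past, $i_k=j$ with probability $P_{i_{k-1},j}(k)$. For $k=0,1,2,\dots$ set $$x^{k+1}_j=\begin{cases}x^k_j-\gamma\big(\nabla_j f(x^k)+\epsilon^k\big), & j=i_k,\\ x^k_j,& j\ne i_k,\end{cases}$$ where $\epsilon^k$ is the error in evaluating the partial derivative in iteration $k$. *)

(* Defs.v *)
From HB Require Import structures.
From mathcomp Require Import all_boot all_order all_algebra.
From mathcomp Require Import all_classical all_reals all_analysis.

Set Implicit Arguments.
Unset Strict Implicit.
Unset Printing Implicit Defensive.

Import Order.TTheory GRing.Theory Num.Theory.
Import numFieldNormedType.Exports.

Local Open Scope classical_set_scope.
Local Open Scope ring_scope.

(* MathComp-Analysis. R^N is ['cV[R]_N]; the indices 1, ..., N become 'I_N. *)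

(* The library norm of ['cV[R]_N] is the sup norm; it is used only through the
   topology and the differential calculus it induces. *)
Definition enorm (R : realType) (N : nat) (v : 'cV[R]_N) : R :=
  Num.sqrt (\sum_(j < N) v j 0 ^+ 2).

Definition spectral_norm (R : realType) (N : nat) (A : 'M[R]_N) : R :=
  sup [set enorm (A *m v) | v in [set v : 'cV[R]_N | enorm v <= 1]].

Definition basis_vec (R : realType) (N : nat) (i : 'I_N) : 'cV[R]_N :=
  delta_mx i 0.

Definition partial (R : realType) (N : nat) (f : 'cV[R]_N -> R) (i : 'I_N)
    (x : 'cV[R]_N) : R :=
  'D_(basis_vec R i) f x.

Definition grad (R : realType) (N : nat) (f : 'cV[R]_N -> R) (x : 'cV[R]_N) :
    'cV[R]_N :=
  \col_j partial f j x.

Definition is_minimizer (R : realType) (N : nat) (f : 'cV[R]_N -> R)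
    (z : 'cV[R]_N) : Prop :=
  forall x, f z <= f x.

(* A minimum as soon as [f] has a minimizer. *)
Definition fmin (R : realType) (N : nat) (f : 'cV[R]_N -> R) : R :=
  inf (range f).

Definition prob_vector (R : realType) (N : nat) (p : 'rV[R]_N) : Prop :=
  (forall j, 0 <= p 0 j) /\ \sum_(j < N) p 0 j = 1.

Definition row_stochastic (R : realType) (N : nat) (A : 'M[R]_N) : Prop :=
  forall i, prob_vector (row i A).

(* [e] is the edge relation of a directed graph; self-loops are allowed. *)
Definition strongly_connected (N : nat) (e : rel 'I_N) : Prop :=
  forall i j, connect e i j.

Definition stationary (R : realType) (N : nat) (P : nat -> 'M[R]_N)
    (p : 'rV[R]_N) : Prop :=
  prob_vector p /\ forall k, p *m P k = p.

(* The smallest entry of a probability vector: the default value 1 is never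
   below it. *)
Definition min_entry (R : realType) (N : nat) (p : 'rV[R]_N) : R :=
  \big[Num.min/1]_(j < N) p 0 j.

Definition stat_mx (R : realType) (N : nat) (p : 'rV[R]_N) : 'M[R]_N :=
  \matrix_(i, j) p 0 j.

(* P(m) P(m+1) ... P(m+n), a product of n+1 matrices in this order. *)
Definition Phi (R : realType) (N : nat) (P : nat -> 'M[R]_N) (m n : nat) :
    'M[R]_N :=
  \prod_(m <= k < (m + n).+1) P k.

Definition markov_chain_assumption (R : realType) (N : nat) (e : rel 'I_N)
    (P : nat -> 'M[R]_N) (p : 'rV[R]_N) : Prop :=
  [/\ strongly_connected e,
      forall k, row_stochastic (P k),
      forall k i j, ~~ e i j -> P k i j = 0,
      stationary P p /\ 0 < min_entry p
    & forall eta : R, 0 < eta ->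
        exists2 t : nat, (1 <= t)%N &
          forall m n : nat, (t - 1 <= n)%N ->
            spectral_norm (Phi P m n - stat_mx p) < eta].

Definition is_mixing_time (R : realType) (N : nat) (P : nat -> 'M[R]_N)
    (p : 'rV[R]_N) (tau : nat) : Prop :=
  (1 <= tau)%N /\
  forall m n : nat, (tau - 1 <= n)%N ->
    spectral_norm (Phi P m n - stat_mx p) <= min_entry p / 2.

(* The sigma-algebra generated by i_0, ..., i_k and eps^0, ..., eps^k. The
   iterates x^0, ..., x^(k+1) are functions of these variables and of x^0. *)
Definition past (R : realType) (N : nat) (T : Type) (i : nat -> T -> 'I_N)
    (eps : nat -> T -> R) (k : nat) : set (set T) :=
  <<s [set A | exists s : nat, (s <= k)%N /\
                 ((exists j : 'I_N, A = i s @^-1` [set j]) \/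
                  (exists2 U : set R, measurable U & A = eps s @^-1` U))] >>.

(* [Z] is a version of the conditional probability of the event [B] given the
   sub-sigma-algebra [G]. *)
Definition is_cond_prob (d : measure_display) (T : measurableType d)
    (R : realType) (Pr : probability T R) (G : set (set T)) (B : set T)
    (Z : T -> R) : Prop :=
  (forall U : set R, measurable U -> G (Z @^-1` U)) /\
  (forall A : set T, G A ->
     (\int[Pr]_(w in A) (Z w)%:E = Pr (A `&` B))%E).

(* The law of i_0 is arbitrary; i_(k+1) is drawn, given the past, from the row
   i_k of P(k+1). The errors are random variables: eps^k may depend on the past
   and on i_k, but it does not anticipate the later draws. *)
Definition block_sampling (d : measure_display) (T : measurableType d)
    (R : realType) (Pr : probability T R) (N : nat) (P : nat -> 'M[R]_N)
    (i : nat -> T -> 'I_N) (eps : nat -> T -> R) : Prop :=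
  [/\ forall k j, measurable (i k @^-1` [set j]),
      forall k, measurable_fun [set: T] (eps k)
    & forall k j, is_cond_prob Pr (past i eps k) (i k.+1 @^-1` [set j])
                    (fun w => P k.+1 (i k w) j)].

(* One trajectory of inexact MC-BCD, for given blocks [i] and errors [eps]. *)
Fixpoint mcbcd (R : realType) (N : nat) (f : 'cV[R]_N -> R) (gamma : R)
    (x0 : 'cV[R]_N) (i : nat -> 'I_N) (eps : nat -> R) (k : nat) : 'cV[R]_N :=
  if k is k'.+1 then
    let x := mcbcd f gamma x0 i eps k' in
    \col_j (if j == i k' then x j 0 - gamma * (partial f j x + eps k')
            else x j 0)
  else x0.

Definition mcbcd_process (R : realType) (N : nat) (T : Type)
    (f : 'cV[R]_N -> R) (gamma : R) (x0 : 'cV[R]_N) (i : nat -> T -> 'I_N)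
    (eps : nat -> T -> R) (k : nat) (w : T) : 'cV[R]_N :=
  mcbcd f gamma x0 (i ^~ w) (eps ^~ w) k.

(* min_{0 <= t <= k} ||grad f (x^t)||^2; the default value is the term t = 0. *)
Definition min_grad_sq (R : realType) (N : nat) (f : 'cV[R]_N -> R)
    (x : nat -> 'cV[R]_N) (k : nat) : R :=
  \big[Num.min/enorm (grad f (x 0%N)) ^+ 2]_(t < k.+1)
     enorm (grad f (x t)) ^+ 2.

Definition C1 (R : realType) (gamma L Lr : R) (tau : nat) : R :=
  4 * gamma / (2 - L * gamma) *
  (2 * Lr ^+ 2 * (tau%:R - 1) ^+ 2 + 4 / gamma ^+ 2).

Definition C2 (R : realType) (gamma L Lr : R) (tau : nat) : R :=
  4 * gamma ^+ 2 / (2 - L * gamma) ^+ 2 *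
  (2 * Lr ^+ 2 * (tau%:R - 1) ^+ 2 + 4 / gamma ^+ 2).

(* Main.v *)
Require Import Defs.
From HB Require Import structures.
From mathcomp Require Import all_boot all_order all_algebra.
From mathcomp Require Import all_classical all_reals all_analysis.
From mathcomp Require Import measurable_realfun ring lra.

Set Implicit Arguments.
Unset Strict Implicit.
Unset Printing Implicit Defensive.

Import Order.TTheory GRing.Theory Num.Theory.
Import numFieldNormedType.Exports.

Local Open Scope classical_set_scope.
Local Open Scope ring_scope.

(** Let al_k = - gamma (d_{i_k} f (x^k) + eps^k) be the signed length of step
    k, where d_j is the j-th partial derivative, and let
    c = 1/gamma - L/2 > 0.

    Along a trajectory, smoothness in one coordinate gives
      f (x^(k+1)) <= f (x^k) - c al_k^2 - al_k eps^k,
    so that the gap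
      D_k = (2/c) (f (x^k) - f (x^(k+1))) + (eps^k)^2 / c^2
    dominates al_k^2 + (al_k + eps^k/c)^2 ([sqr_step_le]). The D_k telescope,
    and their sum over the first M steps is at most
      (2/c) (f (x^0) - min f) + c^-2 sum (eps^k)^2;
    the factors 2/c and 1/c^2 are those of C1 and C2. A partial derivative
    along the block drawn tau - 1 steps later differs from the one evaluated at
    the current iterate by at most Lr times the sum of tau - 1 step lengths. So
    the sum over t of (d_{i_(t+tau)} f (x^(t+1)))^2 is bounded by the D_k and
    the errors ([sum_stale_partial_le]).

    In expectation, x^(t+1) is a function of what happened up to time t. Given
    that past, the block i_(t+tau) is distributed as row i_t of a product of
    tau transition matrices, whose entries are at least pi_min/2. So the
    expected square of d_{i_(t+tau)} f (x^(t+1)) is at least pi_min/2 times the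
    expected squared norm of the full gradient at x^(t+1)
    ([mixed_partial_ge]). This is stated on events of the past first, and
    passes to integrals by approximation with simple functions that are
    measurable for the past.

    The point x^0 needs another argument: the block i_(tau-1) is only tau - 1
    transitions away from i_0, whose law is arbitrary. The squared gradient
    at x^0 is at most 2 L N (f (x^0) - min f), because an exact gradient
    step of stepsize 1/L in one coordinate cannot go below the minimum, and
    N <= 1/pi_min: this is at most one quarter of the claimed bound
    ([ler_4L_C1]). It fits because the estimate for t >= 1 only uses three
    quarters of the bound: (al_k/gamma + eps^k)^2 is at most
    D_k/gamma^2 + (eps^k)^2, without the factor 2 of a sum of two squares, and
    this leaves room to weight the squares of the drift and of the fresh
    derivative by 3/2 and 3 instead of 2 and 2.

    With square summable errors the expected squared gradients have bounded
    partial sums, hence tend to 0, and so do the expected gradients. *)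

(** * Euclidean norm *)

Section enorm_theory.
Variables (R : realType) (N : nat).
Implicit Types v : 'cV[R]_N.

Lemma enorm_ge0 v : 0 <= enorm v.
Proof. exact: sqrtr_ge0. Qed.

Lemma enorm_sqr v : enorm v ^+ 2 = \sum_j v j 0 ^+ 2.
Proof. by rewrite sqr_sqrtr// sumr_ge0// => j _; exact: sqr_ge0. Qed.

Lemma ler_entry_enorm v j : `|v j 0| <= enorm v.
Proof.
rewrite -(@ler_pXn2r _ 2) ?nnegrE ?enorm_ge0// enorm_sqr real_normK ?num_real//.
by rewrite (bigD1 j)//= lerDl sumr_ge0// => i _; exact: sqr_ge0.
Qed.

Lemma enorm_basis_vec (i : 'I_N) : enorm (basis_vec R i) = 1.
Proof.
rewrite /enorm (bigD1 i)//= big1 => [|j ji]; rewrite mxE ?eqxx/=.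
  by rewrite addr0 expr1n sqrtr1.
by rewrite (negbTE ji) expr0n.
Qed.

End enorm_theory.

Lemma sqr_sum_le (R : realDomainType) (n : nat) (a : nat -> R) :
  (\sum_(l < n) a l) ^+ 2 <= n%:R * \sum_(l < n) a l ^+ 2.
Proof.
elim: n => [|n IH]; first by rewrite !big_ord0 expr0n mulr0.
rewrite !big_ord_recr/=; set s := \sum_(_ < _) _ in IH *; set q := \sum_(_ < _) _ in IH *.
have cross : 2 * (s * a n) <= q + n%:R * a n ^+ 2.
  have -> : n%:R * a n ^+ 2 = \sum_(l < n) a n ^+ 2.
    by rewrite sumr_const card_ord mulr_natl.
  rewrite /s /q mulr_suml mulr_sumr -big_split/=.
  by apply: ler_sum => l _; have := sqr_ge0 (a l - a n); nra.
rewrite -natr1; nra.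
Qed.

Lemma ler_sum_shift (R : realDomainType) (a : nat -> R) (k j n : nat) :
  (forall m, 0 <= a m) -> (j <= n)%N ->
  \sum_(t < k) a (t + j)%N <= \sum_(m < k + n) a m.
Proof.
move=> a0 jn.
have -> : (k + n = j + (k + (n - j)))%N by rewrite addnCA subnKC.
rewrite !big_split_ord/=.
under eq_bigr do rewrite addnC.
by rewrite addrCA lerDl addr_ge0// sumr_ge0.
Qed.

(** * Descent along a coordinate *)

Section coordinate_descent.
Variables (R : realType) (N : nat) (f : 'cV[R]_N -> R) (L : R).
Hypothesis f_diff : forall x, differentiable f x.
Hypothesis f_coord_lip : forall (x : 'cV[R]_N) (alpha : R) (i : 'I_N),
  `|partial f i x - partial f i (x + alpha *: basis_vec R i)| <= L * `|alpha|.

Lemma is_derive_line x v (s : R) :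
  is_derive s (1 : R) (fun t : R => f (x + t *: v)) ('D_v f (x + s *: v)).
Proof.
have E : (fun h : R => h^-1 *: (f (x + (h *: (1:R) + s) *: v) - f (x + s *: v)))
   = (fun h => h^-1 *: (f (h *: v + (x + s *: v)) - f (x + s *: v))).
  apply/funext => h; congr (_ *: (f _ - _)).
  by rewrite [h *: 1]mulr1 scalerDl addrCA.
have D : derivable f (x + s *: v) v by exact: diff_derivable.
split; first by rewrite /derivable /= E.
by rewrite /derive /= E.
Qed.

(** One-dimensional descent lemma. The difference of the two sides is
    differentiable along the segment, with a derivative of constant sign by the
    Lipschitz bound, so no integral is needed. *)
Lemma coordinate_descent x i (a : R) :
  f (x + a *: basis_vec R i) <= f x + a * partial f i x + L / 2 * a ^+ 2.
Proof.
set v := basis_vec R i; set g := partial f i x.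
have Dv y : 'D_(a *: v) f y = a * partial f i y.
  by rewrite /partial !deriveE// linearZ.
pose psi (t : R) := f (x + t *: (a *: v)) - t * (a * g) - t ^+ 2 * (L / 2 * a ^+ 2).
pose dpsi (t : R) := a * partial f i (x + t *: (a *: v)) - a * g - L * a ^+ 2 * t.
have psiD (t : R) : is_derive t (1 : R) psi (dpsi t).
  have D1 := is_derive_line x (a *: v) t.
  rewrite Dv in D1.
  rewrite /psi; apply: is_derive_eq.
  by rewrite /dpsi !scaler0 /GRing.scale/=; lra.
have [] := @MVT_segment _ psi dpsi 0 1 ler01 (fun t _ => psiD t).
  apply: continuous_subspaceT => t.
  by apply/differentiable_continuous/derivable1_diffP; have [] := psiD t.
move=> c /itvP c01 psiE.
have {psiE} : psi 1 - psi 0 <= 0.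
  rewrite psiE subr0 mulr1 /dpsi.
  have := f_coord_lip x (c * a) i; rewrite -/g -/v -scalerA distrC normrM.
  rewrite (ger0_norm (_ : 0 <= c)) ?c01// => lip.
  have : a * (partial f i (x + c *: (a *: v)) - g) <= `|a| * (L * (c * `|a|)).
    by rewrite (le_trans (ler_norm _))// normrM ler_wpM2l.
  have -> : `|a| * (L * (c * `|a|)) = L * a ^+ 2 * c.
    by rewrite -(real_normK (num_real a)); ring.
  lra.
rewrite /psi scale1r scale0r addr0 mul0r expr1n expr0n/= !mul1r mul0r !subr0.
by lra.
Qed.

End coordinate_descent.

Section gradient_gap.
Variables (R : realType) (N : nat) (f : 'cV[R]_N -> R) (L : R).
Hypothesis f_diff : forall x, differentiable f x.
Hypothesis f_min : exists z, is_minimizer f z.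
Hypothesis L_gt0 : 0 < L.
Hypothesis f_coord_lip : forall (x : 'cV[R]_N) (alpha : R) (i : 'I_N),
  `|partial f i x - partial f i (x + alpha *: basis_vec R i)| <= L * `|alpha|.

Lemma fmin_le x : fmin f <= f x.
Proof.
have [z zmin] := f_min.
by apply: ge_inf; [exists (f z) => _ [y _ <-]; exact: zmin|exists x].
Qed.

(** A coordinate step of stepsize 1/L decreases [f] by the squared partial
    derivative over 2 L, and [f] cannot go below its minimum. *)
Lemma sqr_grad_le_gap x :
  enorm (grad f x) ^+ 2 <= 2 * L * N%:R * (f x - fmin f).
Proof.
rewrite enorm_sqr.
have -> : 2 * L * N%:R * (f x - fmin f) = \sum_(j < N) 2 * L * (f x - fmin f).
  by rewrite sumr_const card_ord -mulr_natr; ring.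
apply: ler_sum => j _; rewrite mxE; set g := partial f j x.
have := coordinate_descent f_diff f_coord_lip x j (- g / L); rewrite -/g.
have := fmin_le (x + (- g / L) *: basis_vec R j).
set y := f (x + _); move=> h1 h2.
have {h2} : fmin f <= f x - g ^+ 2 / (2 * L).
  apply: (le_trans h1); apply: (le_trans h2).
  by rewrite le_eqVlt; apply/orP; left; apply/eqP; field; rewrite gt_eqF.
by rewrite lerBrDr addrC -lerBrDr ler_pdivrMr ?mulr_gt0// mulrC.
Qed.

End gradient_gap.

(** * Sums along one trajectory *)

Section trajectory.
Variables (R : realType) (N : nat) (f : 'cV[R]_N -> R) (L Lr gamma : R).
Hypothesis f_diff : forall x, differentiable f x.
Hypothesis f_min : exists z, is_minimizer f z.
Hypothesis L_gt0 : 0 < L.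
Hypothesis f_coord_lip : forall (x : 'cV[R]_N) (alpha : R) (i : 'I_N),
  `|partial f i x - partial f i (x + alpha *: basis_vec R i)| <= L * `|alpha|.
Hypothesis f_grad_lip : forall x s : 'cV[R]_N,
  enorm (grad f x - grad f (x + s)) <= Lr * enorm s.
Hypotheses (gamma_gt0 : 0 < gamma) (gamma_lt : gamma < 2 / L).
Variables (x0 : 'cV[R]_N) (i : nat -> 'I_N) (eps : nat -> R).

Let x := mcbcd f gamma x0 i eps.
Let c := gamma^-1 - L / 2.
Let alpha k := - gamma * (partial f (i k) (x k) + eps k).
Let D k := 2 / c * (f (x k) - f (x k.+1)) + eps k ^+ 2 / c ^+ 2.

Lemma mcbcdS k : x k.+1 = x k + alpha k *: basis_vec R (i k).
Proof.
apply/matrixP => j l; rewrite (ord1 l) /= !mxE /alpha/=; case: eqVneq => [->|_] /=.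
  by rewrite mulr1 mulNr.
by rewrite mulr0 addr0.
Qed.

Let c_gt0 : 0 < c.
Proof.
rewrite /c subr_gt0 -(@ltr_pM2r _ gamma)// mulVf ?gt_eqF//.
by move: gamma_lt; rewrite ltr_pdivlMr//; lra.
Qed.

(** Descent reads f(x^k) - f(x^(k+1)) >= c al_k^2 + al_k eps_k. Completing the
    square with (eps_k/c)^2 makes the lower bound nonnegative whatever the
    sign of al_k eps_k. *)
Lemma sqr_step_le k : alpha k ^+ 2 + (alpha k + eps k / c) ^+ 2 <= D k.
Proof.
have := coordinate_descent f_diff f_coord_lip (x k) (i k) (alpha k).
rewrite -mcbcdS => desc.
have gE : partial f (i k) (x k) = - (alpha k / gamma + eps k).
  by rewrite /alpha; field; rewrite gt_eqF.
have : c * alpha k ^+ 2 + alpha k * eps k <= f (x k) - f (x k.+1).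
  by move: desc; rewrite gE /c; lra.
rewrite -(@ler_pM2l _ (2 / c)) ?divr_gt0// => h.
apply: le_trans (lerD h (lexx (eps k ^+ 2 / c ^+ 2))).
by rewrite le_eqVlt; apply/orP; left; apply/eqP; field; rewrite gt_eqF.
Qed.

(** Splitting (al/gamma + eps)^2 into two squares would cost a factor 2 on the
    right-hand side. A large derivative needs al and eps of the same sign, and
    then al + eps/c, hence [D], is large too. *)
Lemma sqr_partial_le k :
  partial f (i k) (x k) ^+ 2 <= D k / gamma ^+ 2 + eps k ^+ 2.
Proof.
apply: le_trans (lerD (ler_wpM2r _ (sqr_step_le k)) (lexx (eps k ^+ 2))); last first.
  by rewrite invr_ge0 sqr_ge0.
have gE : partial f (i k) (x k) = - (alpha k / gamma + eps k).
  by rewrite /alpha; field; rewrite gt_eqF.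
rewrite gE; set a := alpha k; pose y := eps k / c.
have eE : eps k = c * y by rewrite /y; field; rewrite gt_eqF.
have -> : a + eps k / c = a + y by [].
rewrite eE.
(* with u = 1/gamma >= c, this is 2 u c a y <= u^2 (a + y)^2 *)
have cu : c <= gamma^-1 by rewrite /c gerBl divr_ge0// ltW.
rewrite -exprVn; set u := gamma^-1 in cu *.
have u0 : 0 < u by rewrite invr_gt0.
suff : 2 * u * c * (a * y) <= u ^+ 2 * (a + y) ^+ 2 by lra.
have [ay|ay] := leP 0 (a * y).
  have h1 : 2 * u * c * (a * y) <= 2 * u * u * (a * y).
    by rewrite ler_wpM2r// ler_pM2l// mulr_gt0.
  have : 0 <= u ^+ 2 * (a ^+ 2 + y ^+ 2) by rewrite mulr_ge0 ?addr_ge0 ?sqr_ge0.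
  nra.
apply: (@le_trans _ _ 0); last by rewrite mulr_ge0 ?sqr_ge0.
apply: mulr_ge0_le0; last exact: ltW.
by rewrite !mulr_ge0// ltW.
Qed.

Lemma sum_gap_le M :
  \sum_(m < M) D m <=
    2 / c * (f x0 - fmin f) + (\sum_(m < M) eps m ^+ 2) / c ^+ 2.
Proof.
rewrite big_split/= -mulr_sumr -mulr_suml lerD2r.
rewrite ler_pM2l ?divr_gt0//.
suff -> : \sum_(m < M) (f (x m) - f (x m.+1)) = f x0 - f (x M).
  by rewrite lerB// fmin_le.
elim: M => [|M IH]; first by rewrite big_ord0 subrr.
by rewrite big_ord_recr/= IH; lra.
Qed.

Lemma displacement_le m n :
  enorm (x (m + n) - x m) ^+ 2 <= n%:R * \sum_(l < n) alpha (m + l) ^+ 2.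
Proof.
pose b j l := alpha (m + l) * (j == i (m + l))%:R.
have xE j : (x (m + n) - x m) j 0 = \sum_(l < n) b j l.
  elim: n => [|n IH]; first by rewrite addn0 big_ord0 !mxE subrr.
  by rewrite big_ord_recr/= -IH addnS mcbcdS !mxE /b eqxx andbT; ring.
rewrite enorm_sqr; under eq_bigr do rewrite xE.
apply: (@le_trans _ _ (\sum_j n%:R * \sum_(l < n) b j l ^+ 2)).
  by apply: ler_sum => j _; exact: sqr_sum_le.
rewrite -mulr_sumr exchange_big/= ler_wpM2l// ler_sum// => l _.
rewrite (bigD1 (i (m + l)))//= big1 => [|j jl].
  by rewrite /b eqxx mulr1 addr0.
by rewrite /b (negbTE jl) mulr0 expr0n.
Qed.

(** The weights 3/2 and 3 are conjugate, as 2/3 + 1/3 = 1. They leave a common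
    factor 3/4 against the weights 2 and 4 that appear in [C1] and [C2]. *)
Lemma sqr_stale_partial_le k n :
  partial f (i (k + n)) (x k) ^+ 2 <=
  3 / 2 * Lr ^+ 2 * n%:R * (\sum_(l < n) alpha (k + l) ^+ 2) +
  3 * partial f (i (k + n)) (x (k + n)) ^+ 2.
Proof.
set j := i (k + n); set g := partial f j (x (k + n)); set p := partial f j (x k).
have : (p - g) ^+ 2 <= Lr ^+ 2 * (n%:R * \sum_(l < n) alpha (k + l) ^+ 2).
  apply: (@le_trans _ _ (Lr ^+ 2 * enorm (x (k + n) - x k) ^+ 2)); last first.
    by rewrite ler_wpM2l ?sqr_ge0 ?displacement_le.
  have := f_grad_lip (x k) (x (k + n) - x k); rewrite [x k + _]addrC subrK.
  move=> /(le_trans (ler_entry_enorm _ j)); rewrite !mxE -/p -/g => h.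
  by rewrite -exprMn -(real_normK (num_real (p - g))) lerXn2r ?nnegrE// (le_trans _ h).
(* 3 g^2 + (3/2) (p - g)^2 - p^2 = (2 g - (p - g))^2 / 2 *)
have := sqr_ge0 (2 * g - (p - g)).
set s := \sum_(_ < _) _; nra.
Qed.

(** Each step length enters at most tau - 1 of the displacements, which gives
    the factor (tau - 1)^2. The errors weighted by 4 come from the fresh
    derivatives only, so they start at time tau. *)
Lemma sum_stale_partial_le (n k : nat) :
  \sum_(t < k) partial f (i (t + n.+1)) (x t.+1) ^+ 2 <=
  3 / 4 * (C1 gamma L Lr n.+1 * (f x0 - fmin f)
    + C2 gamma L Lr n.+1 * (\sum_(m < k + n.+1) eps m ^+ 2)
    + 4 * \sum_(t < k) eps (t + n.+1) ^+ 2).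
Proof.
have D0 m : 0 <= D m.
  by apply: le_trans (sqr_step_le m); rewrite addr_ge0 ?sqr_ge0.
set SD := \sum_(m < k + n.+1) D m.
have SD_le := sum_gap_le (k + n.+1); rewrite -/SD in SD_le.
set A := Lr ^+ 2 * n%:R.
have A0 : 0 <= A by rewrite mulr_ge0 ?sqr_ge0.
have stale_part : \sum_(t < k) \sum_(l < n) alpha (t.+1 + l) ^+ 2 <= n%:R * SD.
  rewrite exchange_big/=.
  have -> : n%:R * SD = \sum_(l < n) SD by rewrite sumr_const card_ord mulr_natl.
  apply: ler_sum => l _.
  apply: (@le_trans _ _ (\sum_(t < k) D (t + l.+1)%N)).
    apply: ler_sum => t _; rewrite addSnnS; apply: le_trans (sqr_step_le _).
    by rewrite lerDl sqr_ge0.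
  by apply: ler_sum_shift => //; rewrite ltnS ltnW.
have fresh_part : \sum_(t < k) partial f (i (t + n.+1)) (x (t + n.+1)) ^+ 2 <=
    SD / gamma ^+ 2 + \sum_(t < k) eps (t + n.+1) ^+ 2.
  apply: (@le_trans _ _ (\sum_(t < k) (D (t + n.+1) / gamma ^+ 2 + eps (t + n.+1) ^+ 2))).
    by apply: ler_sum => t _; exact: sqr_partial_le.
  rewrite big_split/= -mulr_suml lerD2r ler_wpM2r ?invr_ge0 ?sqr_ge0//.
  exact: ler_sum_shift.
set E2 := \sum_(t < k) eps (t + n.+1) ^+ 2 in fresh_part *.
apply: (@le_trans _ _ (3 / 2 * A * (n%:R * SD) + 3 * (SD / gamma ^+ 2 + E2))).
  apply: (@le_trans _ _ (\sum_(t < k) (3 / 2 * A * (\sum_(l < n) alpha (t.+1 + l) ^+ 2)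
      + 3 * partial f (i (t + n.+1)) (x (t + n.+1)) ^+ 2))).
    apply: ler_sum => t _; have := sqr_stale_partial_le t.+1 n.
    by rewrite addSnnS /A !mulrA.
  rewrite big_split/= -!mulr_sumr lerD//.
    by rewrite ler_wpM2l// mulr_ge0// divr_ge0.
  by rewrite ler_wpM2l.
set K := 2 * Lr ^+ 2 * n%:R ^+ 2 + 4 / gamma ^+ 2.
have -> : 3 / 2 * A * (n%:R * SD) + 3 * (SD / gamma ^+ 2 + E2)
    = 3 / 4 * (K * SD + 4 * E2).
  by rewrite /K /A; field; rewrite gt_eqF.
have K0 : 0 <= K.
  apply: addr_ge0; last by rewrite divr_ge0 ?sqr_ge0.
  by apply: mulr_ge0; [apply: mulr_ge0|]; rewrite ?sqr_ge0.
rewrite ler_pM2l ?divr_gt0// lerD2r.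
apply: (le_trans (ler_wpM2l K0 SD_le)).
rewrite /C1 /C2 -[n.+1%:R]natr1 addrK -/K /c.
have gL : 2 - L * gamma != 0.
  by move: gamma_lt; rewrite ltr_pdivlMr// mulrC => h; rewrite gt_eqF// subr_gt0.
rewrite le_eqVlt; apply/orP; left; apply/eqP; field.
by rewrite gL gt_eqF.
Qed.

(** Already (4 gamma / (2 - L gamma)) (4 / gamma^2) is at least 16 L, because
    L gamma (2 - L gamma) <= 1; this lets [C1] absorb the gradient at the
    starting point. *)
Lemma ler_4L_C1 tau : 4 * L <= C1 gamma L Lr tau.
Proof.
have gL : 0 < 2 - L * gamma.
  by move: gamma_lt; rewrite ltr_pdivlMr// mulrC subr_gt0.
have g2 : 0 < 4 * gamma / (2 - L * gamma) by rewrite divr_gt0 ?mulr_gt0.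
apply: (@le_trans _ _ (4 * gamma / (2 - L * gamma) * (4 / gamma ^+ 2))).
  have -> : 4 * gamma / (2 - L * gamma) * (4 / gamma ^+ 2) =
      16 / (gamma * (2 - L * gamma)).
    by field; rewrite !gt_eqF.
  rewrite ler_pdivlMr ?mulr_gt0//.
  have := sqr_ge0 (L * gamma - 1); lra.
rewrite /C1 ler_wpM2l ?(ltW g2)// lerDr.
by apply: mulr_ge0; [apply: mulr_ge0|]; rewrite ?sqr_ge0.
Qed.

End trajectory.

(** * Comparing integrals on a sub-sigma-algebra *)

Section sub_sigma_algebra.
Local Open Scope ereal_scope.
Import HBNNSimple.

(** A function that is measurable for the sub-sigma-algebra is approximated
    from below by simple functions on the type [g_sigma_algebraType G], whose
    level sets belong to the sub-sigma-algebra; on these the comparison of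
    measures applies term by term. The integral on that type is with respect to
    the image of [mu] by the identity. *)
Lemma ge0_integral_sub_sigma_algebra (d : measure_display)
    (T : measurableType d) (R : realType) (mu : {measure set T -> \bar R})
    (G : set (set T)) (GT : <<s G >> `<=` @measurable d T)
    (B : set T) (mB : measurable B) (c : R) (c0 : (0 <= c)%R)
    (h : T -> R) (h0 : forall w, (0 <= h w)%R)
    (mh : measurable_fun [set: g_sigma_algebraType G] h) :
  (forall A, <<s G >> A -> c%:E * mu A <= mu (A `&` B)) ->
  c%:E * \int[mu]_w (h w)%:E <= \int[mu]_(w in B) (h w)%:E.
Proof.
move=> cB.
pose phi : T -> g_sigma_algebraType G := fun w => w.
have mphi : measurable_fun [set: T] phi.
  by move=> _ A mA; rewrite setTI; exact: GT.
have mhT : measurable_fun [set: T] h.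
  by move=> _ U mU; apply: GT; exact: mh.
have -> : \int[mu]_w (h w)%:E = \int[pushforward mu phi]_w (h w)%:E.
  rewrite [RHS](ge0_integral_pushforward mphi)//.
  - exact/measurable_EFinP.
  - by move=> w _; rewrite lee_fin.
rewrite ge0_integralTE; last by move=> w; rewrite lee_fin.
case: (eqVneq c 0%R) => [->|cN0].
  by rewrite mul0e integral_ge0// => w _; rewrite lee_fin.
have cgt0 : (0 < c)%R by rewrite lt_neqAle eq_sym cN0.
rewrite -lee_pdivlMl//; apply/ge_ereal_sup => _ [s /= sh <-].
rewrite lee_pdivlMl//.
(* the same simple function, for the larger sigma-algebra of T *)
pose s1 : T -> R := s.
have ms : measurable_fun [set: T] s1.
  move=> _ U mU; rewrite setTI; apply: GT; rewrite -[X in <<s _ >> X]setTI.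
  exact: (@measurable_funPT _ _ _ _ s).
have s10 : forall w : T, (0 <= s1 w)%R by move=> w; exact: fun_ge0.
have fs : finite_set (range s1) by exact: (@fimfunP _ _ s).
pose S : {nnsfun T >-> R} := HB.pack s1
  (isMeasurableFun.Build _ _ _ _ _ ms) (FiniteImage.Build _ _ _ fs)
  (isNonNegFun.Build _ _ _ s10).
apply: (@le_trans _ _ (\int[mu]_(w in B) (s1 w)%:E)); last first.
  apply: ge0_le_integral => //.
  - by move=> w _; rewrite lee_fin.
  - by apply/measurable_EFinP; exact: measurable_funTS.
  - by apply/measurable_EFinP; exact: measurable_funTS.
have iS : \int[mu]_(w in B) (s1 w)%:E = sintegral mu (s1 \_ B) by exact: (integral_nnsfun mu mB S).
rewrite iS.
(* both sums are put on a common finite index set; the value 0, taken outside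
   B by the restriction of s, contributes nothing *)
rewrite !sintegralE (fsbig_widen (range s) (range s1 `|` [set 0%R]))/=; last 2 first.
- by move=> _ [w _ <-]; left; exists w.
- by move=> x [[[w _ <-]|->]] /= nw; [case: nw; exists w|rewrite mul0e].
rewrite [leRHS](fsbig_widen (range (s1 \_ B)) (range s1 `|` [set 0%R]))/=; last 2 first.
- by move=> _ [w _ <-]; rewrite /patch; case: ifP => _; [left; exists w|right].
- move=> x /= [_ nx]; rewrite preimage10 ?measure0 ?mule0//.
rewrite ge0_mule_fsumr.
  apply: lee_fsum.
    by rewrite finite_setU; split.
  move=> x xs; have [->|x0] := eqVneq x 0%R; first by rewrite !mul0e mule0.
  have xge0 : (0 <= x)%R by case: xs => [[w _ <-]|/= ->].
  rewrite muleCA; apply: lee_wpmul2l; first by rewrite lee_fin.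
  have -> : (s1 \_ B) @^-1` [set x] = (s1 @^-1` [set x]) `&` B.
    apply/seteqP; split => w /=; rewrite /patch.
      by case: ifPn => [/set_mem|_ xE]; [|case/negP: x0; rewrite -xE].
    by move=> [<- Bw]; rewrite mem_set.
  apply: cB; rewrite -[X in <<s _ >> X]setTI.
  exact: (@measurable_funPT _ _ _ _ s).
move=> x; have [x0|x0] := leP 0%R x; first by rewrite /pushforward; apply: mule_ge0; rewrite ?lee_fin ?measure_ge0.
rewrite preimage10 ?measure0 ?mule0// => -[w _ xE].
by move: x0; rewrite -xE ltNge fun_ge0.
Qed.

End sub_sigma_algebra.

(** * Entries of the transition products *)

Section chain.
Variables (R : realType) (N : nat).

Lemma ler_entry_spectral_norm (A : 'M[R]_N) i j : `|A i j| <= spectral_norm A.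
Proof.
have Av k : (A *m basis_vec R j) k 0 = A k j.
  rewrite mxE (bigD1 j)//= big1 => [|l lj]; rewrite !mxE ?eqxx ?(negbTE lj)/=.
    by rewrite mulr1 addr0.
  by rewrite mulr0.
rewrite -(Av i); apply: (le_trans (ler_entry_enorm _ i)).
apply: ub_le_sup; last first.
  by exists (basis_vec R j) => //=; rewrite enorm_basis_vec.
pose M := \sum_k \sum_l `|A k l|.
exists (Num.sqrt (\sum_(k < N) M ^+ 2)) => _ [v /= v1 <-].
have M0 : 0 <= M by rewrite sumr_ge0// => k _; rewrite sumr_ge0.
apply: ler_wsqrtr; apply: ler_sum => k _.
rewrite -(real_normK (num_real _)) lerXn2r ?nnegrE//.
rewrite mxE (le_trans (ler_norm_sum _ _ _))//.
apply: (@le_trans _ _ (\sum_l `|A k l|)); last first.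
  by rewrite /M [leRHS](bigD1 k)//= lerDl sumr_ge0// => m _; rewrite sumr_ge0.
apply: ler_sum => l _; rewrite normrM ler_piMr// (le_trans _ v1)//.
exact: ler_entry_enorm.
Qed.

Lemma min_entry_le (p : 'rV[R]_N) j : min_entry p <= p 0 j.
Proof. by rewrite /min_entry; exact: bigmin_le_cond. Qed.

Lemma mulrn_min_entry_le1 (p : 'rV[R]_N) : prob_vector p -> N%:R * min_entry p <= 1.
Proof.
move=> [_ p1]; rewrite -[leRHS]p1 mulr_natl -[X in _ *+ X](card_ord N) -sumr_const.
by apply: ler_sum => j _; exact: min_entry_le.
Qed.

(** An entry of a matrix is at most its spectral norm, so an entry of the
    product is within pi_min/2 of an entry of the stationary vector. *)
Lemma half_min_entry_le_Phi (P : nat -> 'M[R]_N) (p : 'rV[R]_N) tau m l j :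
  is_mixing_time P p tau -> min_entry p / 2 <= Phi P m (tau - 1) l j.
Proof.
move=> [_ /(_ m _ (leqnn _))].
move=> /(le_trans (ler_entry_spectral_norm _ l j)); rewrite !mxE.
rewrite ler_norml => /andP[h _].
by have := min_entry_le p j; lra.
Qed.

End chain.

(** * Measurability of the iterates *)

(** An open set of R^N is a countable union of boxes with a rational center and
    a radius 1/(n+1), so measurable coordinates suffice. *)
Lemma measurable_continuous_cV (d : measure_display) (T : measurableType d)
    (R : realType) (N : nat) (X : T -> 'cV[R]_N) (h : 'cV[R]_N -> R) :
  (forall j, measurable_fun [set: T] (fun w => X w j 0)) ->
  continuous h -> measurable_fun [set: T] (h \o X).
Proof.
move=> mX ch.
have mU (U : set 'cV[R]_N) : open U -> measurable (X @^-1` U).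
  move=> oU.
  pose box (q : 'cV[rat]_N * nat) : set 'cV[R]_N :=
    [set y | forall j, `|y j 0 - ratr (q.1 j 0)| < q.2.+1%:R^-1].
  have -> : X @^-1` U = \bigcup_q [set w | box q `<=` U /\ box q (X w)].
    apply/seteqP; split => [w /= Uw|w [q _ [/= ]]]; last exact.
    have [e /= e0 be] : nbhs_ball (X w) U by rewrite nbhs_ballE; exact: open_nbhs_nbhs.
    (* a box of half-width 1/(n+1) through X w has diameter below e *)
    pose n := Num.trunc (2 / e).
    have ne : 2 * n.+1%:R^-1 < e.
      rewrite ltr_pdivrMr ?ltr0n// mulrC -ltr_pdivrMr//; exact: truncnS_gt.
    have n0 : 0 < n.+1%:R^-1 :> R by rewrite invr_gt0 ltr0n.
    have /choice [q qP] : forall j : 'I_N, exists q : rat, `|X w j 0 - ratr q| < n.+1%:R^-1.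
      move=> j; have [|q] := @rat_in_itvoo R (X w j 0) (X w j 0 + n.+1%:R^-1).
        by rewrite ltrDl.
      rewrite in_itv/= => /andP[q1 q2]; exists q.
      by rewrite distrC gtr0_norm ?subr_gt0// ltrBlDl.
    exists (\col_j q j, n) => //; split; last by move=> j /=; rewrite mxE.
    move=> y yb; apply: be; split => // j l; rewrite (ord1 l).
    rewrite /ball/=; have := yb j; rewrite mxE/= => h1; have h2 := qP j.
    rewrite -(subrK (ratr (q j)) (X w j 0)) -addrA (le_lt_trans (ler_normD _ _))//.
    rewrite distrC in h1; apply: lt_trans (ltrD h2 h1) _; by move: ne; rewrite mulr2n mulrDl mul1r.
  apply: (@countable_bigcupT_measurable _ _ _ _ (countableP _)).
  move=> q; have [qU|qU] := pselect (box q `<=` U); last first.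
    rewrite (_ : [set _ | _] = set0)//; apply/seteqP; split => // w []//.
  rewrite (_ : [set _ | _] =
    \bigcap_(j in [set: 'I_N]) ((fun w => `|X w j 0 - ratr (q.1 j 0)|) @^-1` [set` `]-oo, q.2.+1%:R^-1[])).
    apply: fin_bigcap_measurable => //= j _.
    rewrite -[X in measurable X]setTI.
    have mf : measurable_fun [set: T] (fun w => `|X w j 0 - ratr (q.1 j 0)|).
      apply: measurableT_comp => //; apply: measurable_funB => //.
    exact: mf.
  apply/seteqP; split => w /=.
    by move=> [_ bw] j _ /=; rewrite in_itv/=; exact: bw.
  by move=> bw; split => // j; have := bw j I; rewrite /= in_itv.
apply: (measurability _ (RGenOpens.measurableE R)).
move=> _ [_ [a [b ->] <-]]; rewrite setTI.
apply: (mU (h @^-1` `]a, b[%classic)).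
by move/continuousP: ch; apply; exact: interval_open.
Qed.

Section grad_continuity.
Variables (R : realType) (N : nat) (f : 'cV[R]_N -> R) (Lr : R).
Hypothesis f_grad_lip : forall x s : 'cV[R]_N,
  enorm (grad f x - grad f (x + s)) <= Lr * enorm s.

Lemma continuous_partial j : continuous (partial f j).
Proof.
move=> x; have FF : Filter (nbhs x) := nbhs_filter x.
apply/cvgrPdist_lt => e e0.
pose C := `|Lr| * Num.sqrt N%:R + 1.
have C0 : 0 < C by rewrite /C ltr_wpDl// mulr_ge0// sqrtr_ge0.
pose delta := e / C; have delta0 : 0 < delta by rewrite divr_gt0.
have : nbhs x (ball x delta) by exact: nbhsx_ballx.
apply: filterS => y [_ xy].
have := f_grad_lip x (y - x); rewrite [x + _]addrC subrK => h.
have := le_trans (ler_entry_enorm _ j) h; rewrite !mxE => {}h.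
apply: (le_lt_trans h).
have ey : enorm (y - x) <= Num.sqrt N%:R * delta.
  rewrite -[X in _ * X](ger0_norm (ltW delta0)) -sqrtr_sqr -sqrtrM//.
  apply: ler_wsqrtr.
  rewrite mulr_natl -[X in _ *+ X](card_ord N) -sumr_const.
  apply: ler_sum => l _; rewrite !mxE -(real_normK (num_real _)).
  by rewrite lerXn2r ?nnegrE ?(ltW delta0)// distrC ltW//; exact: xy.
apply: (@le_lt_trans _ _ (`|Lr| * (Num.sqrt N%:R * delta))).
  apply: (@le_trans _ _ (`|Lr| * enorm (y - x))).
    by rewrite ler_wpM2r ?enorm_ge0 ?ler_norm.
  by rewrite ler_wpM2l.
have -> : e = C * delta by rewrite /delta; field; rewrite gt_eqF.
by rewrite /C mulrA mulrDl mul1r ltrDl.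
Qed.

End grad_continuity.

(** The generators of [past], named so that their sigma-algebra can be put on
    the type of outcomes: [past i eps k] is the generated one by conversion. *)
Definition past_gen (R : realType) (N : nat) (T : Type) (i : nat -> T -> 'I_N)
    (eps : nat -> T -> R) (k : nat) : set (set T) :=
  [set A | exists s : nat, (s <= k)%N /\
     ((exists j : 'I_N, A = i s @^-1` [set j]) \/
      (exists2 U : set R, measurable U & A = eps s @^-1` U))].

Section past_theory.
Variables (R : realType) (N : nat) (d : measure_display) (T : measurableType d).
Variables (i : nat -> T -> 'I_N) (eps : nat -> T -> R).
Hypothesis mi : forall k j, measurable (i k @^-1` [set j]).
Hypothesis meps : forall k, measurable_fun [set: T] (eps k).

Lemma past_measurable k : past i eps k `<=` @measurable d T.
Proof.
apply: smallest_sub; first exact: sigma_algebra_measurable.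
move=> A [s [_ [[j ->]|[U mU ->]]]]; first exact: mi.
by rewrite -[X in measurable X]setTI; exact: meps.
Qed.

Lemma past_mono k l : (k <= l)%N -> past i eps k `<=` past i eps l.
Proof.
move=> kl; apply: sub_sigma_algebra2 => A [s [sk HA]]; exists s; split => //.
exact: leq_trans sk kl.
Qed.

Lemma past_block s k j : (s <= k)%N -> past i eps k (i s @^-1` [set j]).
Proof. by move=> sk; apply: sub_sigma_algebra; exists s; split => //; left; exists j. Qed.

Lemma past_error s k : (s <= k)%N ->
  measurable_fun [set: g_sigma_algebraType (past_gen i eps k)] (eps s).
Proof.
move=> sk _ U mU; rewrite setTI; apply: sub_sigma_algebra.
by exists s; split => //; right; exists U.
Qed.

Lemma measurable_iterate (f : 'cV[R]_N -> R) gamma x0 k m j :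
  (forall l, continuous (partial f l)) -> (m <= k.+1)%N ->
  measurable_fun [set: g_sigma_algebraType (past_gen i eps k)]
    (fun w => mcbcd_process f gamma x0 i eps m w j 0).
Proof.
move=> cf; elim: m j => [|m IH] j mk; first exact: measurable_cst.
have mx l := IH l (ltnW mk).
rewrite [X in measurable_fun _ X](_ : _ = (fun w => if j == i m w then
    mcbcd_process f gamma x0 i eps m w j 0 -
    gamma * (partial f j (mcbcd_process f gamma x0 i eps m w) + eps m w)
  else mcbcd_process f gamma x0 i eps m w j 0)); last first.
  by apply/funext => w; rewrite /mcbcd_process/= mxE.
apply: measurable_fun_ifT => //.
  apply: (measurable_fun_bool true); rewrite setTI.
  rewrite (_ : _ @^-1` _ = i m @^-1` [set j]); first exact: past_block.
  by apply/seteqP; split => w /= => [/eqP ->|->]; rewrite ?eqxx.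
apply: measurable_funB => //; apply: measurable_funM => //.
apply: measurable_funD; last exact: past_error.
exact: (measurable_continuous_cV mx (cf j)).
Qed.

End past_theory.

(** * The block drawn tau steps later *)

Section mixing.
Variables (R : realType) (N : nat) (d : measure_display) (T : measurableType d).
Variables (Pr : probability T R) (P : nat -> 'M[R]_N).
Variables (i : nat -> T -> 'I_N) (eps : nat -> T -> R).
Hypothesis Psto : forall k, row_stochastic (P k).
Hypothesis samp : block_sampling Pr P i eps.

Let mi k j : measurable (i k @^-1` [set j]).
Proof. by have [mi _ _] := samp. Qed.

Let meps k : measurable_fun [set: T] (eps k).
Proof. by have [_ meps _] := samp. Qed.

Let mpast k A : past i eps k A -> measurable A.
Proof. exact: (past_measurable mi meps). Qed.

Lemma integral_block_fun s (A : set T) (g : 'I_N -> R) :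
  measurable A -> (forall l, 0 <= g l) ->
  (\int[Pr]_(w in A) (g (i s w))%:E =
   \sum_l (g l)%:E * Pr (A `&` i s @^-1` [set l]))%E.
Proof.
move=> mA g0.
have E w : (g (i s w))%:E =
    (\sum_l (g l)%:E * (\1_(i s @^-1` [set l]) w)%:E)%E.
  rewrite (bigD1 (i s w))//= big1 => [|l ls]; rewrite indicE.
    by rewrite mem_set//= mule1 adde0.
  by rewrite memNset ?mule0// => /= /esym/eqP; apply/negP.
under eq_integral do rewrite E.
rewrite ge0_integral_sum//.
- apply: eq_bigr => l _; rewrite ge0_integralZl_EFin//.
  + by rewrite integral_indic// setIC.
  + by apply/measurable_EFinP; exact: measurable_indic.
- move=> l; apply: emeasurable_funM => //.
  by apply/measurable_EFinP; exact: measurable_indic.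
- by move=> l w _; rewrite mule_ge0 ?lee_fin.
Qed.

Lemma block_step k A j : past i eps k A ->
  (Pr (A `&` i k.+1 @^-1` [set j]) =
   \sum_l (P k.+1 l j)%:E * Pr (A `&` i k @^-1` [set l]))%E.
Proof.
move=> Ak; have [_ _ /(_ k j)[_ <-//]] := samp.
rewrite (integral_block_fun k (g := fun l => P k.+1 l j))//; first exact: mpast Ak.
by move=> l; have [+ _] := Psto k.+1 l; move=> /(_ j); rewrite mxE.
Qed.

(** The event [A] belongs to all later pasts, so the transition rule applies
    to it at every step, and the joint law of [A] and the current block is
    multiplied by one matrix each time. *)
Lemma block_law m n A j : past i eps m A ->
  fine (Pr (A `&` i (m + n) @^-1` [set j])) =
  \sum_l fine (Pr (A `&` i m @^-1` [set l])) * (\prod_(m.+1 <= k < (m + n).+1) P k) l j.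
Proof.
move=> Am; elim: n j => [|n IH] j.
  rewrite addn0 big_geq// (bigD1 j)//= big1 => [|l lj]; rewrite mxE.
    by rewrite eqxx mulr1 addr0.
  by rewrite (negbTE lj) mulr0.
rewrite addnS block_step; last by apply: past_mono Am; rewrite leq_addr.
rewrite big_nat_recr ?ltnS ?leq_addr//=.
have mulME (A1 A2 : 'M[R]_N) l l' : (A1 * A2) l l' = \sum_s A1 l s * A2 s l'.
  by rewrite mxE.
under [RHS]eq_bigr do rewrite mulME mulr_sumr.
rewrite exchange_big/= -sum_fine; last first.
  move=> l _; rewrite fin_numM// fin_num_measure//; apply: measurableI => //.
  exact: mpast Am.
apply: eq_bigr => l _; rewrite fineM ?fin_num_measure//; last first.
  by apply: measurableI => //; exact: mpast Am.
rewrite IH /= mulr_sumr; apply: eq_bigr => l' _.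
by rewrite mulrC mulrA.
Qed.

Variables (p : 'rV[R]_N) (tau : nat).
Hypothesis mix : is_mixing_time P p tau.

Lemma mixed_block_prob m A j : past i eps m A ->
  ((min_entry p / 2)%:E * Pr A <= Pr (A `&` i (m + tau) @^-1` [set j]))%E.
Proof.
move=> Am; have mA := mpast Am.
have tau_gt0 : (0 < tau)%N by case: mix.
have fA (s : nat) (l : 'I_N) : (Pr (A `&` i s @^-1` [set l]))%E \is a fin_num.
  by rewrite fin_num_measure//; exact: measurableI.
have PrA : fine (Pr A) = \sum_l fine (Pr (A `&` i m @^-1` [set l])).
  have := integral_block_fun m mA (fun=> ler01 : (0 <= 1 :> R)).
  rewrite integral_cst// mul1e => ->.
  under eq_bigr do rewrite mul1e.
  by rewrite sum_fine.
rewrite -[Pr A]fineK ?fin_num_measure// -[leRHS]fineK// -EFinM lee_fin.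
rewrite block_law// PrA mulr_sumr; apply: ler_sum => l _.
rewrite mulrC ler_wpM2l ?fine_ge0//.
have := half_min_entry_le_Phi m.+1 l j mix.
by rewrite /Phi subn1 addSnnS prednK// addnS.
Qed.

Variables (f : 'cV[R]_N -> R) (gamma : R) (x0 : 'cV[R]_N).
Hypothesis partial_cont : forall j, continuous (partial f j).
Hypothesis min_entry_gt0 : 0 < min_entry p.

Let x := mcbcd_process f gamma x0 i eps.

Lemma past_partial m j :
  measurable_fun [set: g_sigma_algebraType (past_gen i eps m)]
    (fun w => partial f j (x m.+1 w)).
Proof.
have mx l : measurable_fun [set: g_sigma_algebraType (past_gen i eps m)]
    (fun w => x m.+1 w l 0) by exact: measurable_iterate.
exact: (measurable_continuous_cV mx (@partial_cont j)).
Qed.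

Lemma measurable_partial m j : measurable_fun [set: T] (fun w => partial f j (x m w)).
Proof.
case: m => [|m]; first exact: (@measurable_cst _ _ _ _ _ (partial f j x0)).
move=> _ U mU; have := @past_partial m j measurableT _ mU.
by rewrite !setTI; exact: mpast.
Qed.

Lemma measurable_block_partial s m :
  measurable_fun [set: T] (fun w => partial f (i s w) (x m w)).
Proof.
rewrite (_ : (fun w => _) = (fun w => \sum_l \1_(i s @^-1` [set l]) w * partial f l (x m w))).
  apply: measurable_sum => l; apply: measurable_funM; last exact: measurable_partial.
  exact: measurable_indic.
apply/funext => w; rewrite (bigD1 (i s w))//= big1 => [|l ls]; rewrite indicE.
  by rewrite mem_set//= mul1r addr0.
by rewrite memNset ?mul0r// => /= /esym/eqP; apply/negP.
Qed.

Lemma measurable_sqr_grad m :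
  measurable_fun [set: T] (fun w => enorm (grad f (x m w)) ^+ 2).
Proof.
under eq_fun do rewrite enorm_sqr.
apply: measurable_sum => j; apply: measurable_funX.
under eq_fun do rewrite mxE.
exact: measurable_partial.
Qed.

(** Both sides are split over the coordinate j: on the left the squared norm
    into the squared partial derivatives, on the right the integral into the
    events that the drawn block is j. Each pair is compared by
    [mixed_block_prob], as the j-th partial derivative at x^(m+1) is measurable
    for the past at time m. *)
Lemma mixed_partial_ge m :
  ((min_entry p / 2)%:E * \int[Pr]_w (enorm (grad f (x m.+1 w)) ^+ 2)%:E <=
   \int[Pr]_w (partial f (i (m + tau)%N w) (x m.+1 w) ^+ 2)%:E)%E.
Proof.
pose h j w := partial f j (x m.+1 w) ^+ 2.
have h0 j w : 0 <= h j w by exact: sqr_ge0.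
have mh j : measurable_fun [set: T] (h j).
  by apply: measurable_funX; exact: measurable_partial.
pose B j := i (m + tau)%N @^-1` [set j].
have -> : (\int[Pr]_w (enorm (grad f (x m.+1 w)) ^+ 2)%:E =
    \sum_j \int[Pr]_w (h j w)%:E)%E.
  rewrite -ge0_integral_sum//.
  - apply: eq_integral => w _; rewrite enorm_sqr sumEFin; congr (_%:E).
    by apply: eq_bigr => j _; rewrite mxE.
  - by move=> j; exact/measurable_EFinP.
  - by move=> j w _; rewrite lee_fin.
rewrite [leRHS](_ : _ = (\sum_j \int[Pr]_(w in B j) (h j w)%:E)%E); last first.
  under [RHS]eq_bigr do rewrite integral_mkcond.
  rewrite -ge0_integral_sum//.
  - apply: eq_integral => w _; rewrite (bigD1 (i (m + tau)%N w))//= big1.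
      by rewrite patchE mem_set//= adde0.
    by move=> j ji; rewrite patchE memNset// => /= /esym/eqP; apply/negP.
  - move=> j; apply/(measurable_restrictT _ _).1; first exact: mi.
    by apply/measurable_EFinP; exact: measurable_funTS.
  - by move=> j w _; apply: erestrict_ge0 => t _; rewrite lee_fin.
rewrite ge0_sume_distrr; last by move=> j _; apply: integral_ge0 => t _; rewrite lee_fin.
apply: lee_sum => j _.
apply: (ge0_integral_sub_sigma_algebra (G := past_gen i eps m)) => //.
- exact: mpast.
- exact: mi.
- by rewrite divr_ge0// ltW.
- by apply: measurable_funX; exact: past_partial.
- by move=> A; exact: mixed_block_prob.
Qed.

End mixing.

(** * Second moments *)

Section second_moment.
Variables (R : realType) (d : measure_display) (T : measurableType d).
Variable Pr : probability T R.

(** From X <= X^2 / (2 eta) + eta / 2 with eta = sqrt r + delta; the margin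
    [delta] keeps eta positive when [r] is 0. *)
Lemma expectation_le_sqrt_second_moment (X : T -> R) (r delta : R) :
  (forall w, 0 <= X w) -> measurable_fun [set: T] X -> 0 < delta ->
  (\int[Pr]_w (X w ^+ 2)%:E <= r%:E)%E ->
  (\int[Pr]_w (X w)%:E <= (Num.sqrt r + delta)%:E)%E.
Proof.
move=> X0 mX delta0 Xr.
have r0 : 0 <= r.
  by rewrite -lee_fin (le_trans _ Xr)// integral_ge0// => w _; rewrite lee_fin sqr_ge0.
pose eta := Num.sqrt r + delta.
have eta0 : 0 < eta by rewrite ltr_wpDl ?sqrtr_ge0.
have mX2 : measurable_fun [set: T] (fun w => (X w ^+ 2)%:E).
  by apply/measurable_EFinP; exact: measurable_funX.
apply: (@le_trans _ _
    (\int[Pr]_w (((2 * eta)^-1)%:E * (X w ^+ 2)%:E + (eta / 2)%:E))%E).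
  apply: ge0_le_integral => //.
  - by move=> w _; rewrite lee_fin.
  - exact/measurable_EFinP.
  - by apply: emeasurable_funD => //; exact: emeasurable_funM.
  - move=> w _; rewrite -EFinM -EFinD lee_fin.
    have -> : (2 * eta)^-1 * X w ^+ 2 + eta / 2 =
        X w + (X w - eta) ^+ 2 / (2 * eta) by field; rewrite gt_eqF.
    by rewrite lerDl divr_ge0 ?sqr_ge0// mulr_ge0// ltW.
rewrite ge0_integralD//; last 3 first.
- by move=> w _; rewrite -EFinM lee_fin mulr_ge0 ?sqr_ge0// invr_ge0 mulr_ge0// ltW.
- exact: emeasurable_funM.
- by move=> w _; rewrite lee_fin divr_ge0// ltW.
rewrite integral_cst//= probability_setT mule1 ge0_integralZl_EFin//; last 2 first.
- by move=> w _; rewrite lee_fin sqr_ge0.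
- by rewrite invr_ge0 mulr_ge0// ltW.
apply: (@le_trans _ _ (((2 * eta)^-1)%:E * r%:E + (eta / 2)%:E)%E).
  by rewrite leeD2r// lee_wpmul2l// lee_fin invr_ge0 mulr_ge0// ltW.
rewrite -EFinM -EFinD lee_fin -/eta.
have r_eta : r <= eta ^+ 2.
  by rewrite -[leLHS]sqr_sqrtr// lerXn2r ?nnegrE ?sqrtr_ge0 ?(ltW eta0)// lerDl ltW.
have : (2 * eta)^-1 * r <= (2 * eta)^-1 * eta ^+ 2.
  by rewrite ler_wpM2l// invr_ge0 mulr_ge0// ltW.
have -> : (2 * eta)^-1 * eta ^+ 2 = eta / 2 by field; rewrite gt_eqF.
lra.
Qed.

Lemma cvg_expectation_of_summable_sqr (X : nat -> T -> R) (C : R) :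
  (forall k w, 0 <= X k w) -> (forall k, measurable_fun [set: T] (X k)) ->
  (forall k, (\sum_(t < k) \int[Pr]_w (X t w ^+ 2)%:E <= C%:E)%E) ->
  (fun k => \int[Pr]_w (X k w)%:E)%E @ \oo --> 0%E.
Proof.
move=> X0 mX sumC.
pose a k := (\int[Pr]_w (X k w ^+ 2)%:E)%E.
have a0 k : (0 <= a k)%E by rewrite integral_ge0// => w _; rewrite lee_fin sqr_ge0.
have aC k : (a k <= C%:E)%E.
  apply: le_trans (sumC k.+1); rewrite big_ord_recr/= leeDr// sume_ge0// => t _.
  exact: a0.
have afin k : a k \is a fin_num.
  by rewrite ge0_fin_numE// (le_lt_trans (aC k))// ltry.
pose r k := fine (a k).
have r_cvg : r @ \oo --> 0.
  apply: cvg_series_cvg_0; apply: nondecreasing_is_cvgn.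
    by apply: nondecreasing_series => k _ _; exact: fine_ge0.
  exists C => _ [k _ <-]; rewrite /series/= big_mkord -lee_fin.
  apply: le_trans (sumC k); rewrite -sumEFin.
  by apply: lee_sum => t _; rewrite /r fineK.
apply: (@squeeze_cvge _ _ _ _ (cst 0%E) _ (fun k => (Num.sqrt (r k) + harmonic k)%:E)).
- apply: nearW => k; apply/andP; split.
    by rewrite integral_ge0// => w _; rewrite lee_fin.
  apply: expectation_le_sqrt_second_moment => //; first exact: harmonic_gt0.
  by rewrite /r fineK.
- exact: cvg_cst.
- apply: cvg_EFin; first exact: nearW.
  rewrite /comp/= -[X in _ --> X]addr0; apply: cvgD; last exact: cvg_harmonic.
  rewrite -[X in _ --> X](sqrtr0 R).
  exact: (continuous_cvg _ (@sqrt_continuous R 0) r_cvg).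
Qed.

End second_moment.

Lemma min_grad_sq_le (R : realType) (N : nat) (f : 'cV[R]_N -> R) x k t :
  (t <= k)%N -> min_grad_sq f x k <= enorm (grad f (x t)) ^+ 2.
Proof.
move=> tk; have tk1 : (t < k.+1)%N by [].
exact: (bigmin_le _ (Ordinal tk1)).
Qed.

Lemma min_grad_sq_ge0 (R : realType) (N : nat) (f : 'cV[R]_N -> R) x k :
  0 <= min_grad_sq f x k.
Proof.
rewrite /min_grad_sq; elim/big_ind: _ => [|a b a0 b0|t _]; rewrite ?sqr_ge0//.
by rewrite le_min a0.
Qed.

Lemma measurable_min_grad_sq (R : realType) (N : nat) (f : 'cV[R]_N -> R)
    (d : measure_display) (T : measurableType d) (x : nat -> T -> 'cV[R]_N) k :
  (forall m, measurable_fun [set: T] (fun w => enorm (grad f (x m w)) ^+ 2)) ->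
  measurable_fun [set: T] (fun w => min_grad_sq f (x ^~ w) k).
Proof.
move=> mG; rewrite /min_grad_sq; elim: (index_enum _) => [|t s IH].
  by under eq_fun do rewrite big_nil; exact: mG.
by under eq_fun do rewrite big_cons; exact: measurable_minr.
Qed.

(** * Expected gradients *)

Section convergence.
Variables (R : realType) (N : nat) (f : 'cV[R]_N -> R) (L Lr : R).
Hypothesis f_diff : forall x, differentiable f x.
Hypothesis f_min : exists z, is_minimizer f z.
Hypothesis L_gt0 : 0 < L.
Hypothesis f_coord_lip : forall (x : 'cV[R]_N) (alpha : R) (i : 'I_N),
  `|partial f i x - partial f i (x + alpha *: basis_vec R i)| <= L * `|alpha|.
Hypothesis f_grad_lip : forall x s : 'cV[R]_N,
  enorm (grad f x - grad f (x + s)) <= Lr * enorm s.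
Variables (P : nat -> 'M[R]_N) (p : 'rV[R]_N) (tau : nat).
Hypothesis P_sto : forall k, row_stochastic (P k).
Hypotheses (p_prob : prob_vector p) (p_gt0 : 0 < min_entry p).
Hypothesis tau_mixing : is_mixing_time P p tau.
Variable gamma : R.
Hypotheses (gamma_gt0 : 0 < gamma) (gamma_lt : gamma < 2 / L).
Variables (d : measure_display) (T : measurableType d) (Pr : probability T R).
Variables (x0 : 'cV[R]_N) (i : nat -> T -> 'I_N) (eps : nat -> T -> R).
Hypothesis samp : block_sampling Pr P i eps.

Let x := mcbcd_process f gamma x0 i eps.
Let Delta := f x0 - fmin f.
Let G k w := enorm (grad f (x k w)) ^+ 2.
Let bound V1 V2 :=
  C1 gamma L Lr tau * Delta + C2 gamma L Lr tau * V1 + 4 * V2.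

Let G0 k w : 0 <= G k w. Proof. exact: sqr_ge0. Qed.

Let mG k : measurable_fun [set: T] (G k).
Proof.
exact: (measurable_sqr_grad samp gamma x0 (continuous_partial f_grad_lip)).
Qed.

Let Delta0 : 0 <= Delta. Proof. by rewrite subr_ge0 fmin_le. Qed.

Let C1_ge0 : 0 <= C1 gamma L Lr tau.
Proof.
by apply: le_trans (ler_4L_C1 Lr L_gt0 gamma_gt0 gamma_lt tau); rewrite mulr_ge0// ltW.
Qed.

Let C2_ge0 : 0 <= C2 gamma L Lr tau.
Proof.
apply: mulr_ge0; first by rewrite divr_ge0 ?sqr_ge0// mulr_ge0 ?sqr_ge0.
apply: addr_ge0; last by rewrite divr_ge0 ?sqr_ge0.
by apply: mulr_ge0; [apply: mulr_ge0|]; rewrite ?sqr_ge0.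
Qed.

Let bound_ge0 V1 V2 : 0 <= V1 -> 0 <= V2 -> 0 <= bound V1 V2.
Proof. by move=> V10 V20; rewrite /bound !addr_ge0// mulr_ge0. Qed.

(** The errors are summed over all k + tau steps in [V1] and over the k fresh
    derivatives in [V2]: the two noise regimes differ only in these bounds. *)
Lemma sum_expected_sqr_grad_le k V1 V2 : 0 <= V1 -> 0 <= V2 ->
  {ae Pr, forall w, \sum_(m < k + tau) eps m w ^+ 2 <= V1} ->
  {ae Pr, forall w, \sum_(t < k) eps (t + tau)%N w ^+ 2 <= V2} ->
  (\sum_(t < k) \int[Pr]_w (G t.+1 w)%:E <=
   (2 / min_entry p * (3 / 4 * bound V1 V2))%:E)%E.
Proof.
move=> V10 V20 aeV1 aeV2.
pose a t w := partial f (i (t + tau)%N w) (x t.+1 w) ^+ 2.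
have ma t : measurable_fun [set: T] (EFin \o a t).
  apply/measurable_EFinP; apply: measurable_funX.
  exact: (measurable_block_partial samp gamma x0 (continuous_partial f_grad_lip)).
have a0 t w : (0 <= (a t w)%:E)%E by rewrite lee_fin sqr_ge0.
rewrite -[2 / _]invf_div EFinM lee_pdivlMl ?divr_gt0//.
rewrite ge0_sume_distrr; last by move=> t _; apply: integral_ge0 => w _; rewrite lee_fin.
apply: (@le_trans _ _ (\sum_(t < k) \int[Pr]_w (a t w)%:E)%E).
  apply: lee_sum => t _.
  exact: (mixed_partial_ge P_sto samp tau_mixing gamma x0 (continuous_partial f_grad_lip)).
rewrite -ge0_integral_sum//; last by move=> t; exact: ma.
apply: (@le_trans _ _ (\int[Pr]_w cst (3 / 4 * bound V1 V2)%:E w)%E); last first.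
  by rewrite integral_cst//= probability_setT mule1.
apply: ae_ge0_le_integral => //.
- by move=> w _; exact: sume_ge0.
- by apply: emeasurable_sum => t; exact: ma.
- by move=> w _; rewrite lee_fin mulr_ge0 ?divr_ge0 ?bound_ge0.
have [tau_gt0 _] := tau_mixing.
apply: filterS2 aeV1 aeV2 => w V1w V2w _; rewrite sumEFin lee_fin.
have := sum_stale_partial_le f_diff f_min L_gt0 f_coord_lip f_grad_lip
  gamma_gt0 gamma_lt x0 (i ^~ w) (eps ^~ w) tau.-1 k.
rewrite prednK// => /le_trans; apply.
by rewrite ler_pM2l ?divr_gt0// /bound !lerD// ler_wpM2l.
Qed.

(** The starting point takes one quarter of the bound, the later ones three
    quarters. *)
Lemma expected_min_grad_le k V1 V2 : 0 <= V1 -> 0 <= V2 ->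
  {ae Pr, forall w, \sum_(m < k + tau) eps m w ^+ 2 <= V1} ->
  {ae Pr, forall w, \sum_(t < k) eps (t + tau)%N w ^+ 2 <= V2} ->
  (\int[Pr]_w (min_grad_sq f (x ^~ w) k)%:E <=
   (2 / (k.+1%:R * min_entry p) * bound V1 V2)%:E)%E.
Proof.
move=> V10 V20 aeV1 aeV2.
have sumG := sum_expected_sqr_grad_le V10 V20 aeV1 aeV2.
have k0 : 0 < k.+1%:R :> R by rewrite ltr0n.
have mmin : measurable_fun [set: T] (fun w => min_grad_sq f (x ^~ w) k).
  exact: measurable_min_grad_sq.
have -> : 2 / (k.+1%:R * min_entry p) * bound V1 V2 =
    k.+1%:R^-1 * (2 / min_entry p * bound V1 V2).
  by field; rewrite !gt_eqF.
rewrite EFinM lee_pdivlMl//.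
rewrite -ge0_integralZl_EFin//; last 2 first.
- by move=> w _; rewrite lee_fin min_grad_sq_ge0.
- exact/measurable_EFinP.
apply: (@le_trans _ _ (\int[Pr]_w (\sum_(t < k.+1) (G t w)%:E))%E).
  apply: ge0_le_integral => //.
  - by move=> w _; rewrite -EFinM lee_fin mulr_ge0 ?min_grad_sq_ge0.
  - by apply: emeasurable_funM => //; exact/measurable_EFinP.
  - by apply: emeasurable_sum => t; exact/measurable_EFinP.
  move=> w _; rewrite -EFinM sumEFin lee_fin mulr_natl.
  rewrite -[X in _ *+ X](card_ord k.+1) -sumr_const.
  by apply: ler_sum => t _; apply: (min_grad_sq_le f (x ^~ w)); rewrite -ltnS.
rewrite ge0_integral_sum//; last 2 first.
- by move=> t; exact/measurable_EFinP.
- by move=> t w _; rewrite lee_fin.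
rewrite big_ord_recl/= [X in (X + _ <= _)%E](_ : _ = (enorm (grad f x0) ^+ 2)%:E); last first.
  transitivity (\int[Pr]_w cst (enorm (grad f x0) ^+ 2)%:E w)%E; first by [].
  by rewrite integral_cst//= probability_setT mule1.
have G0_le : enorm (grad f x0) ^+ 2 <=
    2 / min_entry p * (1 / 4 * bound V1 V2).
  apply: (le_trans (sqr_grad_le_gap f_diff f_min L_gt0 f_coord_lip x0)).
  rewrite -/Delta.
  have Np : N%:R <= (min_entry p)^-1.
    by rewrite -[leRHS]mul1r ler_pdivlMr// mulrn_min_entry_le1.
  have C1D : 4 * L * Delta <= bound V1 V2.
    rewrite /bound -addrA; apply: (@le_trans _ _ (C1 gamma L Lr tau * Delta)).
      by rewrite ler_wpM2r// ler_4L_C1.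
    by rewrite lerDl addr_ge0// mulr_ge0.
  apply: (@le_trans _ _ (2 * L * (min_entry p)^-1 * Delta)).
    by rewrite ler_wpM2r// ler_wpM2l// mulr_ge0// ltW.
  have : 0 < (min_entry p)^-1 by rewrite invr_gt0.
  set q := (min_entry p)^-1 => q0.
  have := ler_wpM2l (ltW q0) C1D; lra.
apply: (le_trans (leeD (_ : ((enorm (grad f x0) ^+ 2)%:E <= (2 / min_entry p * (1 / 4 * bound V1 V2))%:E)%E) sumG)).
  by rewrite lee_fin.
by rewrite -EFinD lee_fin; lra.
Qed.

End convergence.

Theorem theorem1 (R : realType) (N : nat)
  (f : 'cV[R]_N -> R) (L Lr : R)
  (f_diff : forall x, differentiable f x)
  (f_min : exists z, is_minimizer f z)
  (L_gt0 : 0 < L)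
  (f_coord_lip : forall (x : 'cV[R]_N) (alpha : R) (i : 'I_N),
     `|partial f i x - partial f i (x + alpha *: basis_vec R i)|
       <= L * `|alpha|)
  (f_grad_lip : forall x s : 'cV[R]_N,
     enorm (grad f x - grad f (x + s)) <= Lr * enorm s)
  (e : rel 'I_N) (P : nat -> 'M[R]_N) (pistar : 'rV[R]_N)
  (P_chain : markov_chain_assumption e P pistar)
  (tau : nat) (tau_mixing : is_mixing_time P pistar tau)
  (gamma : R) (gamma_gt0 : 0 < gamma) (gamma_lt : gamma < 2 / L)
  (d : measure_display) (Omega : measurableType d) (Pr : probability Omega R)
  (x0 : 'cV[R]_N) (i : nat -> Omega -> 'I_N) (eps : nat -> Omega -> R)
  (i_sampling : block_sampling Pr P i eps) :
  let x := mcbcd_process f gamma x0 i eps in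
  (* square summable noise *)
  (forall E : R,
     {ae Pr, forall w, (\sum_(0 <= k <oo) (`|eps k w| ^+ 2)%:E <= E%:E)%E} ->
     ((fun k => 'E_Pr[fun w => enorm (grad f (x k w))]%E) @ \oo --> 0%E) /\
     (forall k : nat,
        ('E_Pr[fun w => min_grad_sq f (x ^~ w) k] <=
         (2 / (k.+1%:R * min_entry pistar) *
          (C1 gamma L Lr tau * (f x0 - fmin f)
           + (C2 gamma L Lr tau + 4) * E))%:E)%E)) /\
  (* non-square-summable noise *)
  (forall S : R, 0 < S ->
     (forall k : nat, {ae Pr, forall w, `|eps k w| ^+ 2 <= S}) ->
     forall k : nat,
       ('E_Pr[fun w => min_grad_sq f (x ^~ w) k] <=
        (2 / (k.+1%:R * min_entry pistar) *
         (C1 gamma L Lr tau * (f x0 - fmin f))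
         + 2 / min_entry pistar *
           (C2 gamma L Lr tau * (k + tau)%:R / k.+1%:R + 4) * S)%:E)%E).
Proof.
move=> x.
have [_ P_sto _ [[p_prob _] p_gt0] _] := P_chain.
have pc := continuous_partial f_grad_lip.
have bnd := expected_min_grad_le f_diff f_min L_gt0 f_coord_lip f_grad_lip P_sto
  p_prob p_gt0 tau_mixing gamma_gt0 gamma_lt x0 i_sampling.
have sm := sum_expected_sqr_grad_le f_diff f_min L_gt0 f_coord_lip f_grad_lip P_sto
  p_gt0 tau_mixing gamma_gt0 gamma_lt x0 i_sampling.
have Pr_proper : ProperFilter (almost_everywhere Pr).
  by apply: ae_properfilter_algebraOfSetsType; rewrite /= probability_setT.
split=> [E aeE|S S_gt0 aeS k].
  have E_ge0 : 0 <= E.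
    have [w] := filter_ex aeE; rewrite -lee_fin; apply: le_trans.
    by apply: nneseries_ge0 => k _ _; rewrite lee_fin sqr_ge0.
  have aeE1 k : {ae Pr, forall w, \sum_(m < k + tau) eps m w ^+ 2 <= E}.
    apply: filterS aeE => w; rewrite -lee_fin; apply: le_trans.
    apply: le_trans (nneseries_lim_ge (k + tau) _); last first.
      by move=> m _ _; rewrite lee_fin sqr_ge0.
    rewrite big_mkord sumEFin lee_fin; apply: ler_sum => m _.
    by rewrite real_normK ?num_real.
  have aeE2 k : {ae Pr, forall w, \sum_(t < k) eps (t + tau)%N w ^+ 2 <= E}.
    apply: filterS (aeE1 k) => w; apply: le_trans.
    by apply: (ler_sum_shift (a := fun m => eps m w ^+ 2)) => // m; rewrite sqr_ge0.
  split=> [|k].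
    rewrite -cvg_shiftS; under eq_fun do rewrite unlock.
    apply: (cvg_expectation_of_summable_sqr
      (X := fun k w => enorm (grad f (x k.+1 w)))).
    - by move=> k w; exact: enorm_ge0.
    - move=> k; apply: measurableT_comp; last first.
        apply: measurable_sum => j; apply: measurable_funX.
        under eq_fun do rewrite mxE.
        exact: (measurable_partial i_sampling gamma x0 pc).
      by apply: continuous_measurable_fun; exact: sqrt_continuous.
    - by move=> k; exact: (sm k E E E_ge0 E_ge0 (aeE1 k) (aeE2 k)).
  rewrite unlock; apply: le_trans (bnd k E E E_ge0 E_ge0 (aeE1 k) (aeE2 k)) _.
  by rewrite lee_fin (mulrDl (C2 _ _ _ _)) addrA.
rewrite unlock.
have V1_ge0 : 0 <= (k + tau)%:R * S by rewrite mulr_ge0// ltW.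
have V2_ge0 : 0 <= k%:R * S by rewrite mulr_ge0// ltW.
have aeS' := ae_foralln aeS.
apply: le_trans (bnd k _ _ V1_ge0 V2_ge0 _ _) _.
- apply: filterS aeS' => w Sw.
  rewrite mulr_natl -[X in _ *+ X](card_ord (k + tau)) -sumr_const.
  by apply: ler_sum => m _; rewrite -(real_normK (num_real _)).
- apply: filterS aeS' => w Sw.
  rewrite mulr_natl -[X in _ *+ X](card_ord k) -sumr_const.
  by apply: ler_sum => m _; rewrite -(real_normK (num_real _)).
rewrite lee_fin.
set D := f x0 - fmin f; set c1 := C1 _ _ _ _; set c2 := C2 _ _ _ _.
set K := (k + tau)%:R; set q := min_entry pistar.
have k0 : 0 < k.+1%:R :> R by rewrite ltr0n.
have kE : k%:R = k.+1%:R - 1 :> R by rewrite -natr1 addrK.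
rewrite kE; set n := k.+1%:R in k0 *.
(* there are k fresh errors where the claim allows k + 1: one term 4 S is left *)
have -> : 2 / (n * q) * (c1 * D) + 2 / q * (c2 * K / n + 4) * S =
    2 / (n * q) * (c1 * D + c2 * (K * S) + 4 * ((n - 1) * S)) + 8 * S / (n * q).
  by field; rewrite !gt_eqF.
by rewrite lerDl divr_ge0 ?mulr_ge0// ltW.
Qed.
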